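(* Let $X$ be a compact metric space and $s>0$. Then there exist a compact set $D\subset[0,1]$ and a $1/s$-Hölder onto map $g\colon D\to X$ if and only if $\delta^s(X)<\infty$.
   Context: Let $(X,d)$ be a metric space and $s>0$. For $n\ge1$ let $\mathrm{Sym}(n)$ be the set of bijections $\{1,\dots,n\}\to\{1,\dots,n\}$. For $x_1,\dots,x_n\in X$ define $$Z^s(x_1,\dots,x_n)=\max\left\{\sum_{j=1}^{k-1}(d(x_{i_j},x_{i_{j+1}}))^s: 1=i_1<\dots<i_k=n\right\},$$ $$\delta^s(X)=\sup\left\{\min_{\pi\in\mathrm{Sym}(n)}Z^s(x_{\pi(1)},\dots,x_{\pi(n)}): x_1,\dots,x_n\in X,\ n\ge1\right\}\in[0,\infty].$$ For $\alpha>0$, a map $f$ between metric spaces is $\alpha$-Hölder if there is a finite $C$ with $d_Y(f(x),f(z))\le C\,d_X(x,z)^\alpha$ for all $x,z$ in its domain ($\alpha>1$ is allowed). *)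

(* Defs.v *)
From HB Require Import structures.
From mathcomp Require Import all_boot all_order all_algebra all_fingroup.
From mathcomp Require Import all_classical all_reals all_analysis.

Set Implicit Arguments.
Unset Strict Implicit.
Unset Printing Implicit Defensive.

Import Order.TTheory GRing.Theory Num.Theory.
Import numFieldNormedType.Exports.

Local Open Scope classical_set_scope.
Local Open Scope ring_scope.

(* Points x_1, ..., x_n with n >= 1 are families indexed from 0 by 'I_m.+1,
   with m = n - 1; likewise i_1, ..., i_k is a function on 'I_l.+1, l = k - 1. *)
Definition chain (m l : nat) (i : {ffun 'I_l.+1 -> 'I_m.+1}) : bool :=
  [&& i ord0 == ord0, i ord_max == ord_max &
      [forall a : 'I_l.+1, forall b : 'I_l.+1, (a < b)%N ==> (i a < i b)%N]].

Definition chain_sum (R : realType) (X : metricType R) (s : R) (m : nat)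
    (x : 'I_m.+1 -> X) (l : nat) (i : {ffun 'I_l.+1 -> 'I_m.+1}) : R :=
  \sum_(j < l) (mdist (x (i (inord j))) (x (i (inord j.+1)))) `^ s.

(* A strictly increasing i forces l <= m, so all chains are covered. Chain sums
   are nonnegative and there is at least one chain, so the default value 0 does
   not affect the maximum. *)
Definition Z (R : realType) (X : metricType R) (s : R) (m : nat)
    (x : 'I_m.+1 -> X) : R :=
  \big[Num.max/0]_(l < m.+1)
    \big[Num.max/0]_(i : {ffun 'I_l.+1 -> 'I_m.+1} | chain i) chain_sum s x i.

(* The default value of the minimum is the value at the identity permutation. *)
Definition minZ (R : realType) (X : metricType R) (s : R) (m : nat)
    (x : 'I_m.+1 -> X) : R :=
  \big[Num.min/Z s x]_(pi : 'S_m.+1) Z s (fun j => x (pi j)).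

(* The supremum is taken in [0, +oo]: it is 0, not -oo, when X is empty. *)
Definition delta (R : realType) (X : metricType R) (s : R) : \bar R :=
  maxe 0%E (ereal_sup
    [set v : \bar R | exists (m : nat) (x : 'I_m.+1 -> X), v = (minZ s x)%:E]).

(* The domain is the subtype of a set D (rather than all of A, with conditions
   on D) so that D = set0 and B empty is allowed. *)
Definition holder (R : realType) (A B : metricType R) (D : set A)
    (alpha : R) (f : set_type D -> B) : Prop :=
  exists C : R, forall x z : set_type D,
    mdist (f x) (f z) <= C * (mdist (set_val x) (set_val z)) `^ alpha.

(* Main.v *)
(* If g is 1/s-Hoelder from D to X, ordering points of X like chosen preimages
   makes every chain sum telescope to at most C^s.  Conversely, an ordering
   x_0, ..., x_m with Z^s <= K parametrizes these points: if t_k is the largest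
   chain sum from x_0 to x_k, then d(x_i, x_j)^s <= t_j - t_i for i < j and
   0 <= t_k <= K.  An ultralimit over the finite subsets of X yields
   t : X -> [0, 1], possibly discontinuous, with
   d(x, y)^s <= K |t x - t y|.  This inequality passes to the closure of the
   graph of t, which is compact; D is its projection to [0, 1]. *)
Require Import Defs.
From HB Require Import structures.
From mathcomp Require Import all_boot all_order all_algebra all_fingroup.
From mathcomp Require Import all_classical all_reals all_analysis.
From mathcomp Require Import ring lra.

Set Implicit Arguments.
Unset Strict Implicit.
Unset Printing Implicit Defensive.

Import Order.TTheory GRing.Theory Num.Theory.
Import numFieldNormedType.Exports.

Local Open Scope classical_set_scope.
Local Open Scope ring_scope.

(** * Hölder parametrizations bound all chain sums *)

Lemma sorting_perm (R : realType) (m : nat) (t : 'I_m.+1 -> R) :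
  exists pi : 'S_m.+1, forall a b : 'I_m.+1,
    (a <= b)%N -> t (pi a) <= t (pi b).
Proof.
pose u := [tuple t i | i < m.+1].
have /tuple_permP[pi sE] : perm_eq (sort <=%R u) u.
  by apply/permPl; apply: perm_sort.
exists pi => a b ab.
have nthE (c : 'I_m.+1) : nth 0 (sort <=%R u) c = t (pi c).
  by rewrite sE -tnth_nth !tnth_mktuple.
rewrite -!nthE; apply: (sorted_leq_nth le_trans lexx) => //.
- exact/sort_le_sorted.
- by rewrite inE sE size_tuple.
- by rewrite inE sE size_tuple.
Qed.

Lemma telescope_sum_ord (R : realType) (l : nat) (t : 'I_l.+1 -> R) :
  \sum_(j < l) (t (inord j.+1) - t (inord j)) = t ord_max - t ord0.
Proof.
rewrite -(big_mkord xpredT (fun j => t (inord j.+1) - t (inord j))).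
rewrite (telescope_sumr (fun j => t (inord j)))//.
by congr (t _ - t _); apply: val_inj; rewrite /= inordK.
Qed.

(** Each term of a chain is at most an increment of [t], and the increments telescope to
    [t ord_max - t ord0]. The first hypothesis gives [0 <= c], which the default value 0 of the
    maxima requires. *)
Lemma Z_le (R : realType) (X : metricType R) (s : R) (m : nat)
    (x : 'I_m.+1 -> X) (t : 'I_m.+1 -> R) (c : R) :
  t ord0 <= t ord_max ->
  (forall a b : 'I_m.+1, (a < b)%N ->
    mdist (x a) (x b) `^ s <= t b - t a) ->
  t ord_max - t ord0 <= c -> Z s x <= c.
Proof.
move=> t0m xt tc.
have c0 : 0 <= c by rewrite (le_trans _ tc)// subr_ge0.
apply: bigmax_le => // l _; apply: bigmax_le => // i.
case/and3P => /eqP i0 /eqP im /forallP imono.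
apply: le_trans tc; rewrite -i0 -im -(telescope_sum_ord (t \o i)).
apply: ler_sum => j _; apply: xt.
have /forallP/(_ (inord j.+1))/implyP := imono (inord j); apply.
by rewrite !inordK// ltnS// ltnW.
Qed.

Lemma holder_onto_delta_lty (R : realType) (X : metricType R) (s : R)
    (D : set R^o) (g : set_type D -> X) :
  0 < s -> D `<=` `[0, 1] -> holder s^-1 g -> set_surj setT setT g ->
  (delta X s < +oo)%E.
Proof.
move=> s0 D01 [C gC] gsurj.
pose v (y : set_type D) : R := val y.
(* Raising the Hölder inequality to the power [s] cancels the exponent [s^-1]. Since [C] may be
   negative, [|C|] replaces it first. *)
have gCs (y z : set_type D) :
    mdist (g y) (g z) `^ s <= `|C| `^ s * `|v z - v y|.
  rewrite -[X in _ * X]powRr1// -(mulVf (lt0r_neq0 s0)) powRrM.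
  rewrite -powRM ?powR_ge0//; apply: (ge0_ler_powR (ltW s0));
    rewrite ?nnegrE ?mdist_ge0 ?mulr_ge0 ?powR_ge0//.
  apply: (le_trans (gC y z)).
  by rewrite ler_wpM2r ?powR_ge0// ler_norm.
apply: (@le_lt_trans _ _ (`|C| `^ s)%:E); last exact: ltry.
rewrite ge_max lee_fin powR_ge0/=; apply: ge_ereal_sup => _ [m [x ->]].
rewrite lee_fin.
have [f gf] : {f : 'I_m.+1 -> set_type D & forall i, g (f i) = x i}.
  apply: (@choice _ _ (fun i y => g y = x i)) => i.
  by have [y _ <-] := gsurj (x i) I; exists y.
have [pi tpi] := sorting_perm (v \o f).
apply: (le_trans (bigmin_le_cond _ _ (isT : xpredT pi))).
apply: (@Z_le _ _ _ _ _ (fun i => `|C| `^ s * v (f (pi i)))).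
- by rewrite ler_wpM2l ?powR_ge0// tpi.
- move=> a b ab; rewrite -!gf -mulrBr (le_trans (gCs _ _))//.
  rewrite [X in _ * X]ger0_norm// subr_ge0; apply: tpi; exact: ltnW.
rewrite -mulrBr ler_piMr ?powR_ge0//.
have := D01 _ (set_valP (f (pi ord0))).
have := D01 _ (set_valP (f (pi ord_max))).
rewrite /= !in_itv/= => /andP[_ h1] /andP[h0 _].
by rewrite lerBlDr (le_trans h1)// lerDl.
Qed.

(** * Parametrizing finitely many points *)

(** A chain is encoded by the list of its indices after the initial 0, so that prolonging it is
    [rcons] and its length does not enter the type. *)
Definition path_sum (R : realType) (X : metricType R) (s : R) (y : nat -> X)
    (p : seq nat) : R :=
  \sum_(j < size p) mdist (y (nth 0 (0 :: p) j)) (y (nth 0 p j)) `^ s.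

Lemma path_sum_ge0 (R : realType) (X : metricType R) (s : R) (y : nat -> X)
    (p : seq nat) : 0 <= path_sum s y p.
Proof. by apply: sumr_ge0 => j _; exact: powR_ge0. Qed.

Lemma path_sum_rcons (R : realType) (X : metricType R) (s : R) (y : nat -> X)
    (p : seq nat) (k : nat) :
  path_sum s y (rcons p k) =
  path_sum s y p + mdist (y (last 0 p)) (y k) `^ s.
Proof.
rewrite /path_sum size_rcons big_ord_recr/=; congr (_ + _).
  apply: eq_bigr => j _; rewrite -rcons_cons !nth_rcons/=.
  by rewrite ltn_ord ltnS (ltnW (ltn_ord j)).
by rewrite -rcons_cons !nth_rcons/= ltnn eqxx ltnS leqnn nth_last.
Qed.

Lemma path_sum_le_Z_last (R : realType) (X : metricType R) (s : R) (m : nat)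
    (x : 'I_m.+1 -> X) (p : seq nat) :
  path ltn 0 p -> last 0 p = m -> path_sum s (x \o inord) p <= Z s x.
Proof.
move=> pp pm.
have lt_nth a b : (a < b <= size p)%N ->
    (nth 0 (0 :: p) a < nth 0 (0 :: p) b)%N.
  move=> /andP[ab bp].
  apply: (sorted_ltn_nth ltn_trans 0 (pp : sorted ltn (0 :: p))) => //.
  by rewrite inE/= ltnS (leq_trans (ltnW ab)).
have nth_le a : (a <= size p)%N -> (nth 0 (0 :: p) a <= m)%N.
  have pmE : nth 0 (0 :: p) (size p) = m by rewrite -pm (last_nth 0).
  rewrite leq_eqVlt => /predU1P[->|ap]; first by rewrite pmE.
  by rewrite -pmE ltnW// lt_nth// ap leqnn.
(* The strictly increasing list [0 :: p] has distinct entries, all at most [m]; hence its length is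
   in the range of the outer maximum of [Z]. *)
have size_le : (size p < m.+1)%N.
  rewrite -[m.+1](size_iota 0) -[(size p).+1]/(size (0 :: p)).
  apply: uniq_leq_size.
    exact: (sorted_uniq ltn_trans ltnn (pp : sorted ltn (0 :: p))).
  move=> k /(nthP 0)[a ap <-].
  by rewrite mem_iota/= add0n ltnS nth_le.
pose i := [ffun j : 'I_(size p).+1 => inord (nth 0 (0 :: p) j) : 'I_m.+1].
have iE (j : 'I_(size p).+1) : i j = nth 0 (0 :: p) j :> nat.
  by rewrite ffunE inordK// ltnS nth_le// -ltnS.
have i_chain : chain i.
  apply/and3P; split.
  - by apply/eqP/val_inj; rewrite /= iE.
  - by apply/eqP/val_inj; rewrite /= iE/= -pm (last_nth 0).
  - apply/forallP => a; apply/forallP => b; apply/implyP => ab.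
    by rewrite !iE lt_nth// ab -ltnS/=.
have -> : path_sum s (x \o inord) p = chain_sum s x i.
  apply: eq_bigr => j _; rewrite /i !ffunE/= !inordK//.
    by rewrite ltnS.
  exact: leqW.
apply: le_trans
  (le_bigmax_cond 0 (fun l : 'I_m.+1 =>
    \big[Num.max/0]_(i : {ffun 'I_l.+1 -> 'I_m.+1} | chain i)
      chain_sum s x i) (isT : xpredT (Ordinal size_le))).
exact: le_bigmax_cond.
Qed.

(** A path that stops before [m] is prolonged by a jump to [m], which adds a nonnegative term and
    yields a full chain. *)
Lemma path_sum_le_Z (R : realType) (X : metricType R) (s : R) (m : nat)
    (x : 'I_m.+1 -> X) (p : seq nat) :
  path ltn 0 p -> (last 0 p <= m)%N -> path_sum s (x \o inord) p <= Z s x.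
Proof.
move=> pp; rewrite leq_eqVlt => /predU1P[pm|pm].
  exact: path_sum_le_Z_last.
apply: (@le_trans _ _ (path_sum s (x \o inord) (rcons p m))).
  by rewrite path_sum_rcons lerDl powR_ge0.
by apply: path_sum_le_Z_last; rewrite ?last_rcons// rcons_path pp.
Qed.

(** Let [t k] be the supremum of the path sums ending at [k]. Appending [j] to any path ending at
    [i] gives a path ending at [j], whence the inequality. *)
Lemma Z_parametrization (R : realType) (X : metricType R) (s : R) (m : nat)
    (x : 'I_m.+1 -> X) :
  exists t : 'I_m.+1 -> R, (forall i, 0 <= t i <= Z s x) /\
    forall i j : 'I_m.+1, (i < j)%N -> mdist (x i) (x j) `^ s <= t j - t i.
Proof.
pose P (k : nat) := [set p | path ltn 0 p /\ last 0 p = k].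
pose S k := [set path_sum s (x \o inord) p | p in P k].
have S0 k : S k !=set0.
  case: k => [|k]; first by exists (path_sum s (x \o inord) [::]), [::].
  by exists (path_sum s (x \o inord) [:: k.+1]), [:: k.+1].
have SZ (k : 'I_m.+1) : ubound (S k) (Z s x).
  by move=> _ [p [pp pk] <-]; apply: path_sum_le_Z; rewrite // pk -ltnS.
have hS (k : 'I_m.+1) : has_ubound (S k) by exists (Z s x).
exists (fun k => sup (S k)); split => [i|i j ij].
  apply/andP; split; last exact: ge_sup.
  have [_ [p Pp _]] := S0 i.
  by rewrite (le_trans (path_sum_ge0 s (x \o inord) p))// ub_le_sup//; exists p.
rewrite lerBrDl -lerBrDr; apply: ge_sup => // _ [p [pp pi] <-].
rewrite lerBrDr; apply: ub_le_sup => //.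
exists (rcons p j); first by split; rewrite ?last_rcons// rcons_path pp/= pi.
by rewrite path_sum_rcons/= pi !inord_val.
Qed.

Lemma minZ_parametrization (R : realType) (X : metricType R) (s : R) (m : nat)
    (x : 'I_m.+1 -> X) :
  exists t : 'I_m.+1 -> R, (forall i, 0 <= t i <= minZ s x) /\
    forall i j : 'I_m.+1, i != j -> mdist (x i) (x j) `^ s <= `|t i - t j|.
Proof.
have /bigmin_leP : minZ s x <= minZ s x by [].
rewrite -/(minZ s x) => minP.
have {minP} [pi piZ] : exists pi : 'S_m.+1, Z s (fun j => x (pi j)) <= minZ s x.
  (* In the first case the minimum is its default value [Z s x], which the identity permutation
     attains. *)
  case: minP => [Zm|[pi _ piZ]]; last by exists pi.
  exists 1%g; rewrite [X in Z s X](_ : _ = x)//.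
  by apply/funext => j; rewrite perm1.
have [t [tZ tx]] := Z_parametrization s (fun j => x (pi j)).
exists (fun i => t (pi^-1 i)%g); split => [i|i j ij].
  by have /andP[-> /le_trans ->] := tZ (pi^-1 i)%g.
have : (pi^-1 i != pi^-1 j)%g by rewrite (inj_eq perm_inj).
rewrite -(inj_eq val_inj)/= neq_ltn => /orP[] /tx; rewrite !permKV => /le_trans.
  by apply; rewrite distrC ler_norm.
by rewrite metric_sym; apply; rewrite ler_norm.
Qed.

Lemma delta_lty_bound (R : realType) (X : metricType R) (s : R) :
  (delta X s < +oo)%E ->
  exists2 K : R, 0 < K & forall m (x : 'I_m.+1 -> X), minZ s x <= K.
Proof.
move=> dX; have d0 : (0 <= delta X s)%E by rewrite le_max lexx.
have dfin : delta X s \is a fin_num by rewrite ge0_fin_numE.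
(* The added 1 keeps [K] positive when [delta X s] is 0; [K] later serves as a divisor. *)
exists (fine (delta X s) + 1); first by rewrite ltr_wpDl// fine_ge0.
move=> m x; rewrite -lee_fin EFinD fineK//.
apply: (@le_trans _ _ (delta X s)); last by rewrite leeDl.
by rewrite le_max; apply/orP; right; apply: ereal_sup_ubound; exists m, x.
Qed.

(** * From finite lists of points to the whole space *)

Lemma seq_parametrization (R : realType) (X : metricType R) (s K : R) :
  0 < K -> (forall m (x : 'I_m.+1 -> X), minZ s x <= K) ->
  forall l : seq X, exists t : X -> R, (forall x, 0 <= t x <= 1) /\
    forall x y, x \in l -> y \in l -> x != y ->
      mdist x y `^ s <= K * `|t x - t y|.
Proof.
move=> K0 ZK [|x0 l']; first by exists (fun=> 0); split => // x; rewrite lexx ler01.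
set l := x0 :: l'.
have [t [t01 tl]] := minZ_parametrization s (fun i : 'I_(size l').+1 => nth x0 l i).
(* [index] picks the first occurrence, so repetitions in [l] are harmless. Points outside [l] are
   sent to position 0, which keeps their values in [0, 1]. *)
pose k z : 'I_(size l').+1 := inord (index z l).
have nth_k z : z \in l -> nth x0 l (k z) = z.
  by move=> zl; rewrite inordK ?nth_index// -[X in (_ < X)%N]/(size l) index_mem.
exists (fun x => t (k x) / K); split => [x|x y xl yl xy].
  have /andP[t0 t1] := t01 (k x).
  by rewrite divr_ge0 ?(ltW K0)//= ler_pdivrMr// mul1r (le_trans t1).
rewrite -mulrBl normrM normfV (gtr0_norm K0) mulrCA divff ?mulr1 ?gt_eqF//.
rewrite -{1}(nth_k x xl) -{1}(nth_k y yl); apply: tl.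
by apply: contraNneq xy => kxy; rewrite -(nth_k x xl) kxy nth_k.
Qed.

Lemma space_parametrization (R : realType) (X : metricType R) (s K : R) :
  0 < s -> 0 < K -> (forall m (x : 'I_m.+1 -> X), minZ s x <= K) ->
  exists t : X -> R, (forall x, 0 <= t x <= 1) /\
    forall x y, mdist x y `^ s <= K * `|t x - t y|.
Proof.
move=> s0 K0 ZK.
have [t tP] := choice (seq_parametrization K0 ZK).
(* Along this filter a list eventually contains any given points, so the inequality for each fixed
   pair holds eventually and survives in the limit. *)
pose F := filter_from [set: seq X]
  (fun l0 : seq X => [set l : seq X | {subset l0 <= l}]).
have FF : ProperFilter F.
  apply: filter_from_proper; last by move=> l _; exists l.
  apply: filter_from_filter; first by exists [::].
  move=> l1 l2 _ _; exists (l1 ++ l2) => // l /= sl.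
  by split => x xl; apply: sl; rewrite mem_cat xl ?orbT.
have [G [GU FG]] := ultraFilterLemma FF.
have limt (x : X) : exists a : R,
      0 <= a <= 1 /\ t l x @[l --> G] --> a.
  have [|a [/= a01 ta]] := @segment_compact R 0 1 (t l x @[l --> G]) _.
    apply: (@filterS _ G _ setT) => [l _|]; last exact: filterT.
    by rewrite /= in_itv/=; have [t01 _] := tP l.
  exists a; split; first by rewrite in_itv/= in a01.
  (* A cluster point along an ultrafilter is a limit: otherwise the values would lie in the
     complement of [U] on a set of [G], and clustering would make that complement meet [U]. *)
  move=> U Ua; have [//|GU'] := in_ultra_setVsetC ((t ^~ x) @^-1` U) GU.
  by have [r [nUr Ur]] := ta (~` U) U GU' Ua.
have [u uP] := choice limt.
exists u; split => [x|x y]; first by have [] := uP x.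
have [->|xy] := eqVneq x y.
  by rewrite mdistxx powR0 ?gt_eqF// mulr_ge0// ltW.
have [_ ux] := uP x; have [_ uy] := uP y.
have uxy : K * `|t l x - t l y| @[l --> G] --> K * `|u x - u y|.
  by apply: cvgZr; apply: cvg_norm; apply: cvgB.
apply: (closed_cvg _ (@closed_ge _ _) _ _ uxy).
apply: FG; exists [:: x; y] => // l /= sl; have [_] := tP l; apply => //.
  by apply: sl; rewrite inE eqxx.
by apply: sl; rewrite !inE eqxx orbT.
Qed.

(** * Closing the graph *)

(** Both sides are continuous in [p] and [q]. For [p.1 = q.1] the bound forces [p.2 = q.2], so the
    closed graph is still that of an injective relation from parameters to single points. *)
Lemma closure_graph_holder (R : realType) (X : metricType R) (s K : R)
    (t : X -> R) (p q : R * X) :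
  0 < s -> 0 < K ->
  (forall x y, mdist x y `^ s <= K * `|t x - t y|) ->
  closure [set (t x, x) | x in [set: X]] p ->
  closure [set (t x, x) | x in [set: X]] q ->
  mdist p.2 q.2 `^ s <= K * `|p.1 - q.1|.
Proof.
move=> s0 K0 tK clp clq.
have near_graph (r : R * X) (e : R) : 0 < e ->
    closure [set (t x, x) | x in [set: X]] r ->
    exists x, `|r.1 - t x| < e /\ mdist r.2 x < e.
  move=> e0 /(_ (ball r.1 e `*` ball r.2 e)) [|_ [[x _ <-] [/= h1 h2]]].
    exists (ball r.1 e, ball r.2 e) => //=.
    by split; exact: nbhsx_ballx.
  by exists x; split => //; move: h2; rewrite ballEmdist.
rewrite leNgt; apply/negP => lt_pq.
(* c separates the two sides strictly; e transfers the gap to points of the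
   graph. *)
set a := K * _ in lt_pq; set b := mdist p.2 q.2 in lt_pq.
have a0 : 0 <= a by rewrite mulr_ge0// ltW.
pose c := (a + b `^ s) / 2.
have ac : a < c by rewrite midf_lt.
have cb : c < b `^ s by rewrite midf_lt.
have c0 : 0 <= c by rewrite (le_trans a0)// ltW.
(* The gap is restated for distances because the triangle inequality holds for [mdist], but in
   general not for its power [s]. *)
have cb1 : c `^ s^-1 < b.
  rewrite ltNge; apply/negP => bc; move: cb; rewrite ltNge => /negP; apply.
  rewrite -[X in _ <= X]powRr1// -(mulVf (lt0r_neq0 s0)) powRrM.
  by rewrite ge0_ler_powR ?nnegrE ?powR_ge0 ?mdist_ge0// ltW.
pose e := Num.min ((b - c `^ s^-1) / 2) ((c - a) / (K * 2)).
have e0 : 0 < e by rewrite lt_min !divr_gt0 ?subr_gt0 ?mulr_gt0.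
have eb : e * 2 <= b - c `^ s^-1 by rewrite -ler_pdivlMr// ge_min lexx.
have ea : K * (e * 2) <= c - a.
  by rewrite mulrCA -ler_pdivlMr ?mulr_gt0// ge_min lexx orbT.
have [x [px1 px2]] := near_graph p e e0 clp.
have [y [qy1 qy2]] := near_graph q e e0 clq.
have txy : `|t x - t y| <= `|p.1 - q.1| + e * 2.
  have -> : t x - t y = (p.1 - q.1) - (p.1 - t x) + (q.1 - t y) by ring.
  rewrite (le_trans (ler_normD _ _))// mulr_natr mulr2n [leRHS]addrA.
  by rewrite lerD ?(ltW qy1)// (le_trans (ler_normB _ _))// lerD// ltW.
have dxy : c `^ s^-1 < mdist x y.
  have : b <= mdist p.2 x + (mdist x y + mdist y q.2).
    by rewrite (le_trans (metric_triangle _ x _))// lerD// metric_triangle.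
  rewrite (metric_sym y); lra.
have : mdist x y `^ s <= c.
  rewrite (le_trans (tK x y))// (le_trans (ler_wpM2l (ltW K0) txy))//.
  rewrite mulrDr -/a; lra.
rewrite leNgt => /negP; apply.
rewrite -[X in X < _]powRr1// -(mulVf (lt0r_neq0 s0)) powRrM.
by rewrite gt0_ltr_powR ?nnegrE ?powR_ge0 ?mdist_ge0.
Qed.

Lemma delta_lty_holder_onto (R : realType) (X : metricType R) (s : R) :
  compact [set: X] -> 0 < s -> (delta X s < +oo)%E ->
  exists (D : set R^o) (g : set_type D -> X),
    [/\ compact D, D `<=` `[0, 1], holder s^-1 g & set_surj setT setT g].
Proof.
move=> cX s0 /delta_lty_bound[K K0 ZK].
have [t [t01 tK]] := space_parametrization s0 K0 ZK.
pose G : set (R * X) := [set (t x, x) | x in [set: X]].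
have sub_box : closure G `<=` `[0, 1] `*` setT.
  suff: closure G `<=` fst @^-1` `[0, 1] by move=> GI p /GI.
  have cl01 : closed (@fst R X @^-1` `[0, 1]).
    apply: preimage_closed; last exact: itv_closed.
    by move=> p _; exact: cvg_fst.
  rewrite [X in _ `<=` X](iffLR (closure_id _) cl01); apply: closure_subset.
  by move=> _ [x _ <-]; rewrite /= in_itv/=.
have cG : compact (closure G).
  apply: subclosed_compact sub_box; first exact: closed_closure.
  exact: compact_setX (@segment_compact R 0 1) cX.
pose D : set R^o := fst @` closure G.
(* Any choice of a point above [r] will do, since the fibres of the closed graph over [D] are
   singletons. *)
have DP (r : set_type D) : exists x, closure G (val r, x).
  by case: r => r /= /set_mem[[r' x] Grx <-]; exists x.
have [g gP] := choice DP.
exists D, g; split.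
- apply: (continuous_compact _ cG); apply: continuous_subspaceT.
  by move=> p; exact: cvg_fst.
- by move=> _ [p /sub_box[p01 _] <-].
- exists (K `^ s^-1) => y z.
  have := closure_graph_holder s0 K0 tK (gP y) (gP z); rewrite /= distrC => h.
  rewrite -[leLHS]powRr1 ?mdist_ge0// -(mulfV (lt0r_neq0 s0)) powRrM.
  rewrite -powRM ?(ltW K0)//; last exact: mdist_ge0.
  apply: ge0_ler_powR h; rewrite ?nnegrE ?invr_ge0 ?powR_ge0 ?(ltW s0)//.
  by rewrite mulr_ge0 ?(ltW K0)// mdist_ge0.
move=> x _.
have Gx : closure G (t x, x) by apply: subset_closure; exists x.
have Dx : t x \in D by apply/mem_set; exists (t x, x).
(* Both [x] and the value of [g] at [t x] lie above the parameter [t x], so their distance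
   vanishes. *)
exists (SigSub Dx) => //; apply: mdist_positivity.
have := closure_graph_holder s0 K0 tK (gP (SigSub Dx)) Gx.
rewrite /= subrr normr0 mulr0 => h.
apply: (@powR_eq0_eq0 _ _ s); apply/eqP.
by rewrite eq_le h powR_ge0.
Qed.

Theorem theorem1p12 (R : realType) (X : metricType R) (s : R)
    (hX : compact [set: X]) (hs : 0 < s) :
  (exists (D : set R^o) (g : set_type D -> X),
     [/\ compact D, D `<=` `[0, 1], holder s^-1 g & set_surj setT setT g])
  <-> (delta X s < +oo)%E.
Proof.
split; last exact: delta_lty_holder_onto.
by move=> [D [g [_ D01 gh gs]]]; exact: holder_onto_delta_lty hs D01 gh gs.
Qed.
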